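(* Let $Y=\{1,2,\ldots,m\}$ and $\mathcal{A}=\mathrm{Aut}(\mathcal{T}(Y))$. For a subgroup $G$ of $\mathcal{A}$, let $C_{\mathcal{A}}(G)$ be the centralizer of $G$ in $\mathcal{A}$ and $\widehat{G}$ the topological closure of $G$ in $\mathcal{A}$. (i) If $G$ is an abelian recurrent subgroup of $\mathcal{A}$, then $C_{\mathcal{A}}(G)=\widehat{G}$. (ii) If $m$ is a prime number and $G$ is an infinite abelian state-closed subgroup of $\mathcal{A}$ which acts transitively on the first level of the tree, then $C_{\mathcal{A}}(G)=\widehat{G}$.
   Context: $\mathcal{T}(Y)$ is the rooted $m$-ary tree whose vertices are the elements of the free monoid $Y^{*}$ (finite words over $Y$), with root the empty word and with $u$ joined to $uy$ for $u\in Y^*$, $y\in Y$; the $i$th level is the set of words of length $i$. Automorphisms act on the right. Each $\alpha\in\mathcal{A}$ is written uniquely as $\alpha=(\alpha_y \mid y\in Y)\,\alpha^{\sigma}$ with $\alpha_y\in\mathcal{A}$ and $\alpha^{\sigma}$ the permutation of $Y$ induced by $\alpha$; that is, $\alpha$ maps the word $yw$ to $y^{\alpha^{\sigma}}w^{\alpha_y}$ (so $\mathcal{A}\cong \mathcal{A}^{Y}\rtimes P(Y)$, where $P(Y)$ is the group of permutations of $Y$). The states of $\alpha$ are the elements $\alpha_u$, $u\in Y^{*}$, defined recursively by $\alpha_{\emptyset}=\alpha$ and $\alpha_{yu}=(\alpha_y)_u$. A subgroup $G\leq\mathcal{A}$ is state-closed if all states of every element of $G$ belong to $G$. A state-closed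 subgroup $G$ is recurrent if it acts transitively on the first level $Y$ and, for $y\in Y$, the projection $\pi_y:\mathrm{stab}_G(y)\to G$, $\alpha\mapsto\alpha_y$, from the stabilizer of $y$ in $G$ is onto $G$. $\mathcal{A}$ is a topological group as the inverse limit of its finite quotients $\mathcal{A}/\mathrm{stab}_{\mathcal{A}}(i)$, $i\ge 0$, where $\mathrm{stab}_{\mathcal{A}}(i)$ is the subgroup fixing all vertices of level $i$. *)

(* Defs.v *)
From HB Require Import structures.
From mathcomp Require Import all_boot all_fingroup.
From mathcomp Require Import all_classical topology_structure.

Set Implicit Arguments.
Unset Strict Implicit.
Unset Printing Implicit Defensive.

Local Open Scope classical_set_scope.
Local Open Scope group_scope.

(* The alphabet {1, ..., m} is 'I_m; vertices of the tree are words. *)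
Definition adjacent (m : nat) (u v : seq 'I_m) : Prop :=
  (exists y, v = rcons u y) \/ (exists y, u = rcons v y).

Record treeAut (m : nat) := TreeAut {
  aut_fun :> seq 'I_m -> seq 'I_m;
  aut_bij : bijective aut_fun;
  aut_root : aut_fun [::] = [::];
  aut_adj : forall u v, adjacent (aut_fun u) (aut_fun v) <-> adjacent u v }.

HB.instance Definition _ (m : nat) := gen_eqMixin (treeAut m).
HB.instance Definition _ (m : nat) := gen_choiceMixin (treeAut m).

Lemma treeAutP (m : nat) (a b : treeAut m) : a =1 b -> a = b.
Proof.
case: a => f bf rf af; case: b => g bg rg ag /= /funext fg.
by subst g; congr TreeAut; exact: Prop_irrelevance.
Qed.

Section Group.
Variable m : nat.
Implicit Types a b : treeAut m.

Definition aut_one : treeAut m :=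
  @TreeAut m id (inv_bij (fun=> erefl)) erefl (fun _ _ => iff_refl _).

Fact aut_mul_adj a b u v : adjacent (b (a u)) (b (a v)) <-> adjacent u v.
Proof. by split=> [/aut_adj/aut_adj | uv]; last exact/aut_adj/aut_adj. Qed.

(* Automorphisms act on the right: the left factor is applied first. *)
Definition aut_mul a b : treeAut m :=
  @TreeAut m (b \o a) (bij_comp (aut_bij b) (aut_bij a))
    (etrans (congr1 b (aut_root a)) (aut_root b)) (aut_mul_adj a b).

Fact aut_inv_ex a : exists b : treeAut m, cancel a b /\ cancel b a.
Proof.
have [g fK gK] := aut_bij a.
have gadj u v : adjacent (g u) (g v) <-> adjacent u v.
  by rewrite -[X in _ <-> adjacent X _]gK -[X in _ <-> adjacent _ X]gK aut_adj.
have g0 : g [::] = [::] by rewrite -[in LHS](aut_root a) fK.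
have gb : bijective g by exists a.
by exists (@TreeAut m g gb g0 gadj).
Qed.

Definition aut_inv a : treeAut m := sval (cid (aut_inv_ex a)).

Fact aut_invP a : cancel a (aut_inv a) /\ cancel (aut_inv a) a.
Proof. exact: svalP (cid (aut_inv_ex a)). Qed.

Fact aut_mulA : associative aut_mul.
Proof. by move=> a b c; exact: treeAutP. Qed.

Fact aut_mul1 : left_id aut_one aut_mul.
Proof. by move=> a; exact: treeAutP. Qed.

Fact aut_mulr1 : right_id aut_one aut_mul.
Proof. by move=> a; exact: treeAutP. Qed.

Fact aut_mulV : left_inverse aut_one aut_inv aut_mul.
Proof. by move=> a; apply: treeAutP => u /=; have [_ ->] := aut_invP a. Qed.

Fact aut_mulrV : right_inverse aut_one aut_inv aut_mul.
Proof. by move=> a; apply: treeAutP => u /=; have [-> _] := aut_invP a. Qed.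

HB.instance Definition _ := isGroup.Build (treeAut m)
  aut_mulA aut_mul1 aut_mulr1 aut_mulV aut_mulrV.

Lemma aut_mulE a b u : (a * b) u = b (a u).
Proof. by []. Qed.

Lemma aut_rcons a u y : exists z, a (rcons u y) = rcons (a u) z.
Proof.
elim/last_ind: u y => [|u x IHu] y.
  have /(aut_adj a) : adjacent [::] (rcons [::] y) by left; exists y.
  rewrite aut_root => -[[z ->]|[z]]; first by exists z.
  by case: (a _).
have /(aut_adj a) [[z ->]|[z]] : adjacent (rcons u x) (rcons (rcons u x) y).
- by left; exists y.
- by exists z.
have [t ->] := IHu x => /rcons_inj[/(bij_inj (aut_bij a)) /(congr1 size)].
by rewrite !size_rcons => /eqP; rewrite -addn2 -[X in X == _]addn0 eqn_add2l.
Qed.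

Lemma size_aut a u : size (a u) = size u.
Proof.
elim/last_ind: u => [|u y IHu]; first by rewrite aut_root.
by have [z ->] := aut_rcons a u y; rewrite !size_rcons IHu.
Qed.

Definition root_fun a (y : 'I_m) : 'I_m := head y (a [:: y]).

Definition section_fun a (y : 'I_m) (w : seq 'I_m) : seq 'I_m :=
  behead (a (y :: w)).

Lemma aut_cons_fun a y w : a (y :: w) = root_fun a y :: section_fun a y w.
Proof.
rewrite /section_fun; elim/last_ind: w => [|w x IHw].
  by rewrite /root_fun; move: (size_aut a [:: y]); case: (a _).
rewrite -rcons_cons; have [z ->] := aut_rcons a (y :: w) x.
by rewrite IHw.
Qed.

Fact root_fun_inj a : injective (root_fun a).
Proof.
move=> x y xy; suff: [:: x] = [:: y] by case.
apply: (bij_inj (aut_bij a)); rewrite !aut_cons_fun xy; congr (_ :: _).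
have s0 t : section_fun a t [::] = [::].
  by apply/eqP; rewrite -size_eq0 /section_fun size_behead size_aut.
by rewrite !s0.
Qed.

Definition root_perm a : {perm 'I_m} := perm (@root_fun_inj a).

Fact section_bij a y : bijective (section_fun a y).
Proof.
have [aK aVK] := aut_invP a.
have cancel_section (b c : treeAut m) t : cancel b c ->
    cancel (section_fun b t) (section_fun c (root_fun b t)).
  by move=> bK w; rewrite [LHS]/section_fun -aut_cons_fun bK.
have rK : root_fun (aut_inv a) (root_fun a y) = y.
  by have := aK [:: y]; rewrite !aut_cons_fun => -[].
exists (section_fun (aut_inv a) (root_fun a y)); first exact: cancel_section.
by have := cancel_section _ _ (root_fun a y) aVK; rewrite rK.
Qed.

Fact section_root a y : section_fun a y [::] = [::].
Proof.
by apply/eqP; rewrite -size_eq0 /section_fun size_behead size_aut.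
Qed.

Fact adjacent_cons (x : 'I_m) u v : adjacent (x :: u) (x :: v) <-> adjacent u v.
Proof.
by split=> -[] [z e]; [left|right|left|right]; exists z;
   [case: e|case: e|rewrite e|rewrite e].
Qed.

Fact section_adj a y u v :
  adjacent (section_fun a y u) (section_fun a y v) <-> adjacent u v.
Proof.
by rewrite -(adjacent_cons (root_fun a y)) -!aut_cons_fun aut_adj adjacent_cons.
Qed.

Definition section a y : treeAut m :=
  @TreeAut m _ (section_bij a y) (section_root a y) (section_adj a y).

Lemma aut_cons a y w : a (y :: w) = root_perm a y :: section a y w.
Proof. by rewrite permE aut_cons_fun. Qed.

Fixpoint state a (u : seq 'I_m) : treeAut m :=
  if u is y :: v then state (section a y) v else a.

Definition level_stab (i : nat) : set (treeAut m) :=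
  [set a | forall u, size u = i -> a u = u].

(* The inverse limit topology, with the finite quotients by the level
   stabilisers discrete, has the cosets of these stabilisers as a base. *)
Definition level_coset (p : treeAut m * nat) : set (treeAut m) :=
  [set p.1 * s | s in level_stab p.2].

Lemma level_cosetP a i b :
  level_coset (a, i) b <-> forall u, size u = i -> b u = a u.
Proof.
split=> [[s si <-] u ui|ab].
  by rewrite aut_mulE si // size_aut.
exists (a^-1 * b); last by rewrite mulKVg.
move=> u ui; have [_ aVK] := aut_invP a.
by rewrite aut_mulE ab ?size_aut // aVK.
Qed.

HB.instance Definition _ := isPointed.Build (treeAut m) 1.

Fact level_coset_cover : \bigcup_(p in setT) level_coset p = setT.
Proof.
apply/seteqP; split=> // a _; exists (a, 0%N) => //.
exact/level_cosetP.
Qed.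

Fact aut_take a u i : a (take i u) = take i (a u).
Proof.
elim/last_ind: u => [|u y IHu] /=; first by rewrite aut_root.
have [z e] := aut_rcons a u y.
have [ui|ui] := leqP i (size u).
  by rewrite e -!cats1 !takel_cat ?size_aut.
by rewrite !take_oversize ?size_aut ?size_rcons.
Qed.

Fact level_cosetW a b i j : (i <= j)%N ->
  level_coset (a, j) b -> level_coset (a, i) b.
Proof.
move=> ij /level_cosetP ab; apply/level_cosetP => u ui.
have [u0|u_n0] := eqVneq u [::]; first by rewrite u0 !aut_root.
have y : 'I_m by case: u u_n0 {ui}.
have <- : take i (u ++ nseq (j - i) y) = u by rewrite take_size_cat.
by rewrite !aut_take ab // size_cat size_nseq ui subnKC.
Qed.

Fact level_coset_join p q a : setT p -> setT q ->
  level_coset p a -> level_coset q a ->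
  exists r, [/\ setT r, level_coset r a &
                level_coset r `<=` level_coset p `&` level_coset q].
Proof.
case: p q => [b i] [c j] _ _ /level_cosetP ba /level_cosetP ca.
exists (a, maxn i j); split=> //; first exact/level_cosetP.
move=> d ad; split; apply/level_cosetP => u ui.
  by rewrite -ba //; move/level_cosetP: (level_cosetW (leq_maxl i j) ad); exact.
by rewrite -ca //; move/level_cosetP: (level_cosetW (leq_maxr i j) ad); exact.
Qed.

HB.instance Definition _ := isBaseTopological.Build (treeAut m)
  level_coset_cover level_coset_join.

End Group.

Section Subgroups.
Variable m : nat.
Implicit Type G : set (treeAut m).

Definition is_subgroup G : Prop := group_closed (fun g => g \in G).

Definition is_abelian G : Prop := forall g h, G g -> G h -> commute g h.

Definition centralizer G : set (treeAut m) :=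
  [set a | forall g, G g -> commute a g].

Definition state_closed G : Prop := forall g u, G g -> G (state g u).

Definition level1_transitive G : Prop :=
  forall x y : 'I_m, exists2 g, G g & root_perm g x = y.

Definition letter_stab G (y : 'I_m) : set (treeAut m) :=
  [set g | G g /\ root_perm g y = y].

Definition recurrent G : Prop :=
  [/\ state_closed G,
      level1_transitive G &
      forall y : 'I_m, set_surj (letter_stab G y) G (fun g => section g y)].

End Subgroups.

(* Main.v *)
(* Once G is transitive on every level, the centralizer is the closure: the
   finite group induced on a level is abelian and transitive, hence equal to its
   own centralizer.  A recurrent group is transitive on every level by induction.
   In case (ii), commutation with a first-level transitive set forces an element
   of G fixing a level to have equal states at all vertices of that level.  As G
   is infinite, some such element fixes level n and has a state with nontrivial
   root permutation; m being prime, this permutation is an m-cycle, so its powers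
   link all the children of any vertex of level n. *)
Require Import Defs.
From mathcomp Require Import all_boot all_fingroup.
From mathcomp Require Import all_classical topology_structure.

Set Implicit Arguments.
Unset Strict Implicit.
Unset Printing Implicit Defensive.

Local Open Scope classical_set_scope.
Local Open Scope group_scope.

(** * Closure in the inverse limit topology, read level by level *)

Lemma nbhs_level_coset m (a : treeAut m) i : nbhs a (level_coset (a, i)).
Proof.
rewrite nbhsE /=; exists (level_coset (a, i)) => //.
split; last exact/level_cosetP.
by exists [set (a, i)] => //; rewrite bigcup_set1.
Qed.

Lemma nbhs_sub_level_coset m (a : treeAut m) (B : set (treeAut m)) :
  nbhs a B -> exists i, level_coset (a, i) `<=` B.
Proof.
rewrite nbhsE => -[U [[D _ <-] [[b i] Dbi /level_cosetP ab]] UB].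
exists i => c /level_cosetP ac; apply: UB; exists (b, i) => //.
by apply/level_cosetP => u ui; rewrite ac ?ab.
Qed.

Lemma closure_levelP m (G : set (treeAut m)) a :
  closure G a <->
  forall i, exists2 g, G g & forall u, size u = i -> g u = a u.
Proof.
split=> [Ga i|Ga B /nbhs_sub_level_coset[i aB]].
  by have [g [Gg /level_cosetP ga]] := Ga _ (nbhs_level_coset a i); exists g.
by have [g Gg ga] := Ga i; exists g; split=> //; exact/aB/level_cosetP.
Qed.

(** Since [g] preserves levels, one element of [G] approximating [a] on the level of [u] serves at
    both [u] and [g u]. *)
Lemma closure_sub_centralizer m (G : set (treeAut m)) :
  is_abelian G -> closure G `<=` centralizer G.
Proof.
move=> abG a /closure_levelP Ga g Gg; apply: treeAutP => u.
have [b Gb ba] := Ga (size u).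
by rewrite !aut_mulE -ba // -ba ?size_aut // -!aut_mulE (abG b g Gb Gg).
Qed.

Definition level_transitive m (G : set (treeAut m)) : Prop :=
  forall u v : seq 'I_m, size u = size v -> exists2 g, G g & g u = v.

(** If [a] and [g] agree at a single vertex [u] and both commute with [h], they agree at [h u]; such
    vertices fill the level. *)
Lemma centralizer_level_transitive m (G : set (treeAut m)) : (0 < m)%N ->
  is_abelian G -> level_transitive G -> centralizer G = closure G.
Proof.
move=> m0 abG trG; apply/seteqP; split; last exact: closure_sub_centralizer.
move=> a Ca; apply/closure_levelP => i; pose u := nseq i (Ordinal m0).
have su : size u = i by rewrite size_nseq.
have [g Gg gu] : exists2 g, G g & g u = a u by apply: trG; rewrite size_aut.
exists g => // v sv; have [h Gh <-] : exists2 h, G h & h u = v.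
  by apply: trG; rewrite su.
by rewrite -!aut_mulE (abG h g) // -(Ca h) // !aut_mulE gu.
Qed.

Lemma recurrent_level_transitive m (G : set (treeAut m)) :
  is_subgroup G -> recurrent G -> level_transitive G.
Proof.
move=> sgG [_ tr1 surjG]; have GM := group_closedM sgG.
move=> u v; have [n] := ubnP (size u).
elim: n u v => // n IHn [|x u] [|y v] //=.
  by move=> _ _; exists 1; [have := sgG.1; rewrite inE|rewrite aut_root].
rewrite ltnS => un [suv]; have [g Gg gx] := tr1 x y.
have [h Gh huv] : exists2 h, G h & h (section g x u) = v.
  by apply: IHn; rewrite size_aut.
(* Recurrence lifts the correction [h] of the tail to an element fixing the letter [y]. *)
have [k [Gk ky] kh] := surjG y h Gh.
exists (g * k).
  by have := GM g k; rewrite !inE; exact.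
by rewrite aut_mulE !aut_cons gx ky kh huv.
Qed.

Lemma aut_cat m (a : treeAut m) u w : a (u ++ w) = a u ++ state a u w.
Proof.
elim: u a => [|x u IHu] a /=; first by rewrite aut_root.
by rewrite !aut_cons IHu.
Qed.

Lemma aut_rcons_perm m (a : treeAut m) u x :
  a (rcons u x) = rcons (a u) (root_perm (state a u) x).
Proof. by rewrite -!cats1 aut_cat aut_cons aut_root. Qed.

Lemma root_permM m (a b : treeAut m) :
  root_perm (a * b) = root_perm a * root_perm b.
Proof.
apply/permP => x; rewrite permM.
by have := erefl ((a * b) [:: x]); rewrite {1}aut_mulE !aut_cons => -[].
Qed.

Lemma prime_transitive_cycle (p : nat) (R : {group 'S_p}) (s : 'S_p) :
  prime p -> abelian R -> (forall x y, exists2 t, t \in R & t x = y) ->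
  s \in R -> s != 1 -> forall x y, exists k, (s ^+ k) x = y.
Proof.
move=> p_pr abR trR Rs s1 x y.
(* The action is regular: [t] fixing [x] commutes with [r], so it fixes [r x], which is arbitrary.
   Hence [R] has order [p]. *)
have stab1 : 'C_R[x | 'P] = 1.
  apply/trivgP/fintype.subsetP => t /setIP[Rt /astab1P tx].
  apply/set1P/permP => z; rewrite perm1; have [r Rr <-] := trR x z.
  by rewrite -permM (centsP abR r Rr t Rt) permM; congr (r _).
have cardR : #|R| = p.
  rewrite -(card_orbit_stab 'P R x) stab1 cards1 muln1 -[RHS]card_ord -cardsT.
  congr #|pred_of_set _|; apply/setP => z; rewrite inE.
  by have [t Rt <-] := trR x z; exact: mem_orbit.
have sR : <[s]> = R.
  have sub_sR : <[s]> \subset R by rewrite cycle_subG.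
  apply/eqP; rewrite eqEcard sub_sR cardR.
  have := cardSg sub_sR; rewrite cardR => /(prime_nt_dvdP p_pr) -> /=.
    exact: leqnn.
  by rewrite -trivg_card1 cycle_eq1.
have [t Rt <-] := trR x y.
by move: Rt; rewrite -sR => /cycleP[k ->]; exists k.
Qed.

Section StateClosed.
Variables (m : nat) (G : set (treeAut m)).
Hypotheses (sgG : is_subgroup G) (abG : is_abelian G) (scG : state_closed G)
  (tr1 : level1_transitive G).

Let G1 : G 1.
Proof. by have := sgG.1; rewrite inE. Qed.

Let GM g h : G g -> G h -> G (g * h).
Proof. by have := @group_closedM _ _ sgG g h; rewrite !inE => GM Gg Gh; exact: GM. Qed.

Let GV g : G g -> G g^-1.
Proof. by have := @group_closedV _ _ sgG g; rewrite !inE. Qed.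

Let GX g k : G g -> G (g ^+ k).
Proof. by move=> Gg; elim: k => // k IHk; rewrite expgS; exact: GM. Qed.

(** With [h] sending [y] to [x], the sections of [h * g] and [g * h] at [y] give
    [h_y g_x = g_y h_y]. Both [h_y] and [g_y] lie in the abelian [G], so [h_y] cancels. *)
Lemma section_letter_stab g x y : G g -> root_perm g y = y ->
  section g x = section g y.
Proof.
move=> Gg gy; have [h Gh hy] := tr1 y x.
have Gs f z : G f -> G (section f z) by exact: (@scG f [:: z]).
apply: (mulgI (section h y)); rewrite (abG (Gs _ _ Gh) (Gs g y Gg)).
apply: treeAutP => w.
have := congr1 (fun f : treeAut m => f (y :: w)) (abG Gh Gg).
by rewrite !aut_mulE !aut_cons gy hy => -[].
Qed.

Lemma state_level_stab n g u v : G g -> level_stab n g ->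
  size u = n -> size v = n -> state g u = state g v.
Proof.
elim: n g u v => [|n IHn] g [|x u] [|y v] //= Gg gn [su] [sv].
have := gn (x :: u) (congr1 S su); rewrite aut_cons => -[gx _].
rewrite (section_letter_stab y Gg gx); apply: IHn => //.
  exact: (@scG g [:: x]).
move=> w sw; have := gn (x :: w) (congr1 S sw).
by rewrite aut_cons => -[].
Qed.

Lemma level_stab_infinite n : infinite_set G ->
  exists g, [/\ G g, level_stab n g & g != 1].
Proof.
move=> infG; apply: contrapT => noG; apply: infG.
have act_size (g : treeAut m) (t : n.-tuple 'I_m) : size (g t) == n.
  by rewrite size_aut size_tuple.
pose f g := [ffun t => Tuple (act_size g t)].
(* If only the identity of [G] fixed level [n], then [G] would embed in the finite set of maps on
   [n]-tuples. *)
have f_inj : {in G &, injective f}.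
  move=> g h; rewrite !inE => Gg Gh fgh; apply: (mulIg h^-1); rewrite mulgV.
  apply: contrapT => /eqP gh1; apply: noG; exists (g * h^-1); split=> //.
    exact/GM/GV.
  move=> u /eqP su.
  have /(congr1 val) := congr1 (fun k => (k : {ffun _ -> _}) (Tuple su)) fgh.
  by rewrite !ffunE aut_mulE /= => ->; rewrite -aut_mulE mulgV.
by rewrite -(eq_finite_set (inj_card_eq f_inj)); exact: finite_finset.
Qed.

Lemma level_stab_active_state n : infinite_set G ->
  exists g u, [/\ G g, level_stab n g, size u = n & root_perm (state g u) != 1].
Proof.
case/(level_stab_infinite n) => g [Gg gn g1].
have [v gv] : exists v, g v != v.
  apply: contrapT => fix_g; case/eqP: g1; apply: treeAutP => v.
  by apply/eqP; apply: contrapT => /negP gv; apply: fix_g; exists v.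
(* Induction on a moved word: if [g] fixes level [n.+1] too, its section at [x] still fixes level
   [n] and moves the shorter word [v]. Otherwise a moved word of length [n.+1] reveals the active
   state. *)
elim: v g Gg gn gv {g1} => [|x v IHv] g Gg gn gv.
  by rewrite aut_root eqxx in gv.
have [gSn|NgSn] := pselect (level_stab n.+1 g).
  have fix_section w : size w = n -> x :: w = root_perm g x :: section g x w.
    by move=> sw; rewrite -aut_cons gSn //= sw.
  have [gx _] := fix_section _ (size_nseq n x).
  apply: (IHv (section g x)); first exact: (@scG g [:: x]).
    by move=> w /fix_section[].
  by apply: contraNneq gv => gxv; rewrite aut_cons gxv -gx.
have /existsNP[w /not_implyP[sw /eqP gw]] := NgSn.
case/lastP: w sw gw => // u y; rewrite size_rcons => -[su] guy.
exists g, u; split=> //; apply: contraNneq guy => s1.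
by rewrite aut_rcons_perm s1 perm1 gn.
Qed.

(** Packages the action on the first level as a finite group, so that orbit counting applies. *)
Lemma root_image_group : exists2 R : {group {perm 'I_m}}, abelian R &
  forall s, s \in R <-> exists2 g, G g & root_perm g = s.
Proof.
have inR s : s \in [set s | `[< exists2 g, G g & root_perm g = s >]]%SET <->
    exists2 g, G g & root_perm g = s by rewrite inE; split=> /asboolP.
have root1 : root_perm (1 : treeAut m) = 1.
  by apply: (mulgI (root_perm (1 : treeAut m))); rewrite -root_permM !mulg1.
have gR : group_set [set s | `[< exists2 g, G g & root_perm g = s >]]%SET.
  apply/group_setP; split=> [|s t /inR[g Gg <-] /inR[h Gh <-]]; apply/inR.
    by exists 1.
  by exists (g * h); [exact: GM|rewrite root_permM].
exists (group gR) => //; apply/centsP => s /inR[g Gg <-] t /inR[h Gh <-].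
by rewrite /commute -!root_permM (abG Gg Gh).
Qed.

Lemma prime_root_cycle c x y : prime m -> G c -> root_perm c != 1 ->
  exists k, (root_perm c ^+ k) x = y.
Proof.
move=> m_pr Gc c1; have [R abR inR] := root_image_group.
apply: (@prime_transitive_cycle m R) => //; last by apply/inR; exists c.
move=> z t; have [g Gg gz] := tr1 z t.
by exists (root_perm g) => //; apply/inR; exists g.
Qed.

Lemma prime_infinite_level_transitive : prime m -> infinite_set G ->
  level_transitive G.
Proof.
move=> m_pr infG u; elim/last_ind: u => [|u x IHu] v.
  by case: v => // _; exists 1 => //; rewrite aut_root.
case/lastP: v => [|v y]; rewrite !size_rcons // => -[suv].
have [g Gg gu] := IHu v suv.
have [c [w [Gc cn sw cw]]] := level_stab_active_state (size v) infG.
(* The active state is known only at [w]; equality of states carries it to [v]. *)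
have cv : state c v = state c w by exact: (state_level_stab Gc cn).
have [k kxy] := prime_root_cycle (root_perm (state g u) x) y m_pr
  (scG w Gc) cw.
exists (g * c ^+ k); first exact/GM/GX.
rewrite aut_mulE aut_rcons_perm gu -kxy.
(* As [c] fixes [v], its powers act on the children of [v] by the powers of one permutation. *)
elim: k {kxy} => [|k IHk]; first by rewrite !expg0 perm1.
by rewrite !expgSr aut_mulE IHk aut_rcons_perm cn // cv permM.
Qed.

End StateClosed.

Theorem theorem7 (m : nat) (hm : (0 < m)%N) :
  (forall G : set (treeAut m),
     is_subgroup G -> is_abelian G -> recurrent G ->
     centralizer G = closure G)
  /\
  (prime m ->
   forall G : set (treeAut m),
     is_subgroup G -> is_abelian G -> infinite_set G -> state_closed G ->
     level1_transitive G ->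
     centralizer G = closure G).
Proof.
split=> [G sgG abG recG|].
  exact: (centralizer_level_transitive hm abG
    (recurrent_level_transitive sgG recG)).
move=> m_pr G sgG abG infG scG tr1.
exact: (centralizer_level_transitive hm abG
  (prime_infinite_level_transitive sgG abG scG tr1 m_pr infG)).
Qed.
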